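(* Let $D > d \geq 1$ be integers, let $\sigma > 0$, and let $\mathcal{S}_1, \mathcal{S}_2 \subset \mathbb{R}^D$ be two $d$-dimensional linear subspaces. Let $y = x + n$, where $x \in \mathcal{S}_1$ is fixed and $n \sim \mathcal{N}(0, \sigma^2 I_D)$. Define $$\mu(y) = 1 - \frac{\mathrm{dist}(y, \mathcal{S}_1)}{\mathrm{dist}(y, \mathcal{S}_2)}.$$ Then there is an absolute constant $c > 0$ such that for every $\varepsilon \in (0,1)$, with probability at least $1 - 4e^{-c\varepsilon^2 (D-d)}$, $$1 - \frac{(1+\varepsilon)\sqrt{\sigma^2 (D-d)}}{(1-\varepsilon)\sqrt{\sigma^2(D-d) + \mathrm{dist}(x,\mathcal{S}_2)^2}} \;\leq\; \mu(y) \;\leq\; 1 - \frac{(1-\varepsilon)\sqrt{\sigma^2 (D-d)}}{(1+\varepsilon)\sqrt{\sigma^2(D-d) + \mathrm{dist}(x,\mathcal{S}_2)^2}}.$$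
   Context: For a linear subspace $\mathcal{S} \subset \mathbb{R}^D$ with orthonormal basis matrix $U$, $\mathrm{dist}(z, \mathcal{S}) = \min_{w \in \mathcal{S}} \|z - w\|_2 = \|z - UU^T z\|_2$. *)

(* Defs.v *)
From HB Require Import structures.
From mathcomp Require Import all_boot all_order all_algebra.
From mathcomp Require Import all_classical all_reals all_analysis.
Set Implicit Arguments. Unset Strict Implicit. Unset Printing Implicit Defensive.
Import Order.TTheory GRing.Theory Num.Theory.
Local Open Scope classical_set_scope.
Local Open Scope ring_scope.

Definition norm2 {R : realType} {D : nat} (z : 'cV[R]_D) : R :=
  Num.sqrt (\sum_(i < D) (z i 0) ^+ 2).

(* A d-dimensional linear subspace S of R^D is given by a matrix U with
   orthonormal columns (U^T U = I_d); S is the column space of U. *)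
Definition orthonormal_cols {R : realType} {D d : nat} (U : 'M[R]_(D, d)) : Prop :=
  U^T *m U = 1%:M.

Definition dist_sub {R : realType} {D d : nat} (U : 'M[R]_(D, d)) (z : 'cV[R]_D) : R :=
  norm2 (z - U *m (U^T *m z)).

Definition in_span {R : realType} {D d : nat} (U : 'M[R]_(D, d)) (x : 'cV[R]_D) : Prop :=
  exists a : 'cV[R]_d, x = U *m a.

Definition mutually_independent {R : realType} {dT : measure_display}
  {T : measurableType dT} (P : probability T R) {D : nat} (X : 'I_D -> T -> R) : Prop :=
  forall (J : {set 'I_D}) (B : 'I_D -> set R),
    (forall i, measurable (B i)) ->
    P (\bigcap_(i in [set i | i \in J]) (X i @^-1` B i)) =
    (\prod_(i in J) P (X i @^-1` B i))%E.

Definition gaussian_vector {R : realType} {dT : measure_display}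
  {T : measurableType dT} (P : probability T R) {D : nat} (sigma : R)
  (X : 'I_D -> T -> R) : Prop :=
  (forall i, measurable_fun setT (X i)) /\
  (forall i (B : set R), measurable B -> P (X i @^-1` B) = normal_prob 0 sigma B) /\
  mutually_independent P X.

Definition vec_of {R : realType} {dT : measure_display} {T : measurableType dT}
  {D : nat} (X : 'I_D -> T -> R) (t : T) : 'cV[R]_D := \col_i X i t.

Definition mu_score {R : realType} {D d : nat} (U1 U2 : 'M[R]_(D, d)) (y : 'cV[R]_D) : R :=
  1 - dist_sub U1 y / dist_sub U2 y.

(* Main.v *)
Require Import Defs.
From HB Require Import structures.
From mathcomp Require Import all_boot all_order all_algebra.
From mathcomp Require Import all_classical all_reals all_analysis.
From mathcomp Require Import finmap measurable_realfun ring lra.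
Import Order.TTheory GRing.Theory Num.Theory.
Local Open Scope classical_set_scope.
Local Open Scope ring_scope.

(* Up to the factor sigma^2, the squared distance of x + n to a d-dimensional
   subspace is a noncentral chi-square variable Z with m = D - d degrees of
   freedom and noncentrality delta^2 = dist(x, S)^2 / sigma^2, and
   E exp(theta Z) = (1 - 2 theta)^(-m/2) exp(theta delta^2 / (1 - 2 theta)).
   This formula is obtained without rotation invariance: for a unit vector a,
   exp(tau <a, g>^2) is the average of exp(h sqrt(2 tau) <a, g>) over a standard
   normal h, which reduces everything to exponentials of diagonal quadratics,
   where independence applies.  The identity needs tau >= 0; for theta > 0 it is
   applied to a basis of the orthogonal complement of S, and for theta < 0 to the
   basis of S itself, via Z = |g + v|^2 - |proj_S (g + v)|^2.  With
   theta = (kappa - 1) / (2 kappa) and ln kappa <= kappa - 1, the Chernoff bound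
   at kappa^2 (m + delta^2) is exp(- (kappa - 1)^2 m / 2), and kappa = 1 + eps or
   1 - eps for both subspaces gives four bad events and c = 1/2. *)

(** * Change of variables under a weighted law *)

Section weighted_law.
Context {R : realType} {d1 d2 : measure_display} {T1 : measurableType d1}
  {T2 : measurableType d2}.
Context (mu : {measure set T1 -> \bar R}) (nu : {measure set T2 -> \bar R}).
Context (F : T1 -> R) (Y : T1 -> T2) (c : R).
Hypothesis mF : measurable_fun setT F.
Hypothesis F0 : forall t, 0 <= F t.
Hypothesis mY : measurable_fun setT Y.
Hypothesis lawY : forall B, measurable B ->
  (\int[mu]_t (F t * \1_B (Y t))%:E = c%:E * nu B)%E.

Import HBNNSimple.

Let measurable_F_comp (g : T2 -> R) : measurable_fun setT g ->
  measurable_fun setT (fun t => F t * g (Y t)).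
Proof.
by move=> mg; apply: measurable_funM => //; exact: measurableT_comp.
Qed.

Let weighted_law_nnsfun (h : {nnsfun T2 >-> R}) :
  (\int[mu]_t (F t * h (Y t))%:E = c%:E * \int[nu]_y (h y)%:E)%E.
Proof.
pose s := fset_set (h @` setT); pose n := #|` s|%fset.
pose A i := h @^-1` [set s`_i].
have s0 (i : 'I_n) : 0 <= s`_i.
  have : s`_i \in s by rewrite mem_nth.
  rewrite in_fset_set// => /set_mem[y _ <-]; exact: fun_ge0.
have mA i : measurable (A i) by exact: measurable_sfunP.
transitivity (\sum_(i < n) \int[mu]_t ((s`_i)%:E * (F t * \1_(A i) (Y t))%:E))%E.
  rewrite -ge0_integral_sum//.
  - apply: eq_integral => t _; rewrite fimfunEord mulr_sumr -sumEFin.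
    by apply: eq_bigr => i _; rewrite -EFinM mulrCA.
  - move=> i; apply: emeasurable_funM => //; apply/measurable_EFinP/measurable_F_comp.
    exact: measurable_indic.
  - by move=> i t _; rewrite -EFinM lee_fin !mulr_ge0// indicE.
transitivity (\sum_(i < n) (c%:E * \int[nu]_y (s`_i * \1_(A i) y)%:E))%E.
  apply: eq_bigr => i _; rewrite ge0_integralZl//=.
  - rewrite lawY// muleCA.
    under [in RHS]eq_integral do rewrite EFinM.
    rewrite ge0_integralZl//= ?integral_indic// ?setIT//.
    + exact/measurable_EFinP/measurable_indic.
    + by rewrite lee_fin.
  - by apply/measurable_EFinP/measurable_F_comp; exact: measurable_indic.
  - by move=> t _; rewrite lee_fin mulr_ge0// indicE.
  - by rewrite lee_fin.
rewrite -ge0_sume_distrr; last first.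
  by move=> i _; apply: integral_ge0 => y _; rewrite lee_fin mulr_ge0// indicE.
congr (_ * _)%E; rewrite -ge0_integral_sum//.
- by apply: eq_integral => y _; rewrite fimfunEord sumEFin.
- by move=> i; apply/measurable_EFinP/measurable_funM => //; exact: measurable_indic.
- by move=> i y _; rewrite lee_fin mulr_ge0// indicE.
Qed.

(** [lawY] says that the image under [Y] of the measure with density [F] is [c] times [nu]; simple
    functions and monotone convergence carry this from indicators to [f]. It serves once with [F] a
    product of the other independent factors, and once with [F] a density and [Y] the identity. *)
Lemma ge0_integral_weighted_law (f : T2 -> R) :
  measurable_fun setT f -> (forall y, 0 <= f y) ->
  (\int[mu]_t (F t * f (Y t))%:E = c%:E * \int[nu]_y (f y)%:E)%E.
Proof.
move=> mf f0.
have mEf : measurable_fun setT (EFin \o f) by exact/measurable_EFinP.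
pose h := nnsfun_approx measurableT mEf.
have hf y : (h n y)%:E @[n --> \oo] --> (f y)%:E.
  by apply: cvg_nnsfun_approx => // z _; rewrite lee_fin.
have hnd y : {homo h^~ y : m n / (m <= n)%N >-> m <= n}.
  by move=> m n mn; exact/lefP/nd_nnsfun_approx.
have lhs : (\int[mu]_t (F t * h n (Y t))%:E)%E @[n --> \oo] -->
    (\int[mu]_t (F t * f (Y t))%:E)%E.
  rewrite (_ : (fun t => (F t * f (Y t))%:E) =
      (fun t => limn (fun n => (F t * h n (Y t))%:E))); last first.
    apply/funext => t; apply/esym/cvg_lim => //.
    under eq_fun do rewrite EFinM.
    by rewrite EFinM; apply: cvgeZl.
  apply: cvg_monotone_convergence => //.
  - by move=> n; exact/measurable_EFinP/measurable_F_comp.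
  - by move=> n t _; rewrite lee_fin mulr_ge0.
  - by move=> t _ m n mn; rewrite lee_fin ler_wpM2l// hnd.
have rhs : (c%:E * \int[nu]_y (h n y)%:E)%E @[n --> \oo] -->
    (c%:E * \int[nu]_y (f y)%:E)%E.
  apply: cvgeZl => //.
  rewrite (_ : (fun y => (f y)%:E) = (fun y => limn (fun n => (h n y)%:E))); last first.
    by apply/funext => y; exact/esym/cvg_lim.
  apply: cvg_monotone_convergence => //.
  - by move=> n; exact/measurable_EFinP.
  - by move=> n y _; rewrite lee_fin.
  - by move=> y _ m n mn; rewrite lee_fin hnd.
rewrite (_ : (fun n => _) = (fun n => c%:E * \int[nu]_y (h n y)%:E)%E) in lhs.
  exact: (cvg_unique _ lhs rhs).
by apply/funext => n; exact: weighted_law_nnsfun.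
Qed.

End weighted_law.

Lemma integralT_indic {R : realType} {d : measure_display} {T : measurableType d}
  (mu : {measure set T -> \bar R}) (A : set T) :
  measurable A -> (\int[mu]_x (\1_A x)%:E = mu A)%E.
Proof. by move=> mA; rewrite integral_indic// setIT. Qed.

(** * Expectation of a product of independent factors *)

Section independent_product.
Context {R : realType} {dT : measure_display} {T : measurableType dT}.
Context (P : probability T R) {D : nat} (X : 'I_D -> T -> R).
Context (nu : {measure set (measurableTypeR R) -> \bar R}).
Hypothesis mX : forall i, measurable_fun setT (X i).
Hypothesis lawX : forall i (B : set R), measurable B -> P (X i @^-1` B) = nu B.
Hypothesis indepX : mutually_independent P X.

(* Induction on the number [k] of factors that are not indicators: the integral
   is a measure in each indicator, hence extends to nonnegative functions. *)
Let integral_prod_indic k (f : 'I_D -> R -> R) (c : 'I_D -> R) :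
  (forall i, measurable_fun setT (f i)) -> (forall i x, 0 <= f i x) ->
  (forall i, \int[nu]_x (f i x)%:E = (c i)%:E)%E ->
  (forall i : 'I_D, (k <= i)%N -> exists2 B, measurable B & f i = \1_B) ->
  (\int[P]_t (\prod_i f i (X i t))%:E = (\prod_i c i)%:E)%E.
Proof.
elim: k f c => [|k IH] f c mf f0 fc fB.
  have {fB}[B mB fE] : exists2 B : 'I_D -> set R,
      forall i, measurable (B i) & forall i, f i = \1_(B i).
    have /choice[B HB] : forall i, exists B : set R, measurable B /\ f i = \1_B.
      by move=> i; have [B mB E] := fB i (leq0n i); exists B.
    by exists B => i; case: (HB i).
  have cE i : P (X i @^-1` B i) = (c i)%:E.
    by rewrite lawX// -fc fE; exact/esym/(integralT_indic nu (B i) (mB i)).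
  have := indepX [set: 'I_D]%SET B mB.
  set C := (X in P X); move=> PC.
  have mC : measurable C.
    apply: fin_bigcap_measurable => [|i _]; first exact: finite_finset.
    by rewrite -[_ @^-1` _]setTI; exact: mX.
  transitivity (P C); last first.
    by rewrite PC -prodEFin; apply: eq_big => i; rewrite ?inE.
  rewrite -integralT_indic//; apply: eq_integral => t _.
  congr EFin; rewrite indicE; case: (boolP (t \in C)) => [|] tC.
    rewrite big1// => i _; rewrite fE indicE mem_set//.
    by apply: (set_mem tC); rewrite /= inE.
  apply/eqP; rewrite prodf_seq_eq0; apply: contraNT tC => /hasPn h.
  apply/mem_set => i _ /=; have := h i (mem_index_enum i).
  by rewrite /= fE indicE; case: (boolP (_ \in _)) => [/set_mem//|_]; rewrite eqxx.
(* Once [k] reaches [D], no index lies beyond it and the indicator condition is vacuous. *)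
have [kD|Dk] := ltnP k D; last first.
  apply: IH => // i ki; exfalso.
  by move: (leq_trans Dk ki); rewrite leqNgt ltn_ord.
pose i0 := Ordinal kD.
(* With the factor at [i0] replaced by an indicator, only [k] general factors remain. The induction
   hypothesis then gives the weighted law of [X i0], the weight being the product of the other
   factors. *)
have weighted_indic (B : set R) : measurable B ->
    (\int[P]_t (\prod_(i < D | i != i0) f i (X i t) * \1_B (X i0 t))%:E =
     (\prod_(i < D | i != i0) c i)%:E * nu B)%E.
  move=> mB.
  have nuB : nu B = (fine (nu B))%:E.
    rewrite fineK// -(lawX i0)// fin_num_measure//.
    by rewrite -[_ @^-1` _]setTI; exact: mX.
  pose f' i := if i == i0 then \1_B else f i.
  pose c' i := if i == i0 then fine (nu B) else c i.
  have := IH f' c'; rewrite [in X in _ -> _ -> _ -> _ -> _ = X](bigD1 i0)//=.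
  rewrite {2}/c' eqxx EFinM -nuB muleC (eq_bigr c); last first.
    by rewrite /c' => i /negbTE ->.
  move=> <-.
  - apply: eq_integral => t _; congr EFin; rewrite [RHS](bigD1 i0)//= mulrC.
    rewrite {1}/f' eqxx; congr (_ * _); apply: eq_bigr => i /negbTE ii0.
    by rewrite /f' ii0.
  - by move=> i; rewrite /f'; case: ifP => // _; exact: measurable_indic.
  - by move=> i x; rewrite /f'; case: ifP => // _; rewrite indicE.
  - move=> i; rewrite /f' /c'; case: ifP => // _.
    by rewrite -nuB; exact: (integralT_indic nu).
  - move=> i ki; rewrite /f'; case: eqP => [_|/eqP ii0]; first by exists B.
    by apply: fB; rewrite ltn_neqAle ki andbT; apply: contra ii0 => /eqP ki'; exact/eqP/val_inj.
under eq_integral do rewrite (bigD1 i0)//= mulrC.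
rewrite (ge0_integral_weighted_law P nu
  (fun t => \prod_(i < D | i != i0) f i (X i t)) (X i0)
  (\prod_(i < D | i != i0) c i) _ _ _ _ (f i0))//.
- by rewrite fc -EFinM [in RHS](bigD1 i0)//= mulrC.
- under eq_fun do rewrite -big_filter.
  by apply: measurable_prod => i _ _; exact: measurableT_comp.
- by move=> t; rewrite prodr_ge0.
- exact: mX.
- exact: mf.
Qed.

Lemma integral_prod_independent (f : 'I_D -> R -> R) (c : 'I_D -> R) :
  (forall i, measurable_fun setT (f i)) -> (forall i x, 0 <= f i x) ->
  (forall i, \int[nu]_x (f i x)%:E = (c i)%:E)%E ->
  (\int[P]_t (\prod_i f i (X i t))%:E = (\prod_i c i)%:E)%E.
Proof.
move=> mf f0 fc; apply: (integral_prod_indic D) => // i.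
by rewrite leqNgt ltn_ord.
Qed.

End independent_product.

(** * One-dimensional Gaussian integrals *)

Lemma ge0_integral_normal_prob {R : realType} (m sigma : R) (f : R -> R) :
  measurable_fun setT f -> (forall x, 0 <= f x) ->
  (\int[normal_prob m sigma]_x (f x)%:E =
   \int[lebesgue_measure]_x (normal_pdf m sigma x * f x)%:E)%E.
Proof.
move=> mf f0; rewrite -[LHS]mul1e.
rewrite -(ge0_integral_weighted_law (@lebesgue_measure R) (normal_prob m sigma)
  (normal_pdf m sigma) idfun 1 _ _ _ _ f)//.
- exact: measurable_normal_pdf.
- by move=> x; exact: normal_pdf_ge0.
- exact: measurable_id.
- move=> B mB; rewrite mul1e /normal_prob [RHS]integral_mkcond.
  apply: eq_integral => x _; rewrite patchE indicE.
  by case: ifP; rewrite ?mulr1 ?mulr0.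
Qed.

(** Tilting a centred normal law by a quadratic exponent gives a normal law of mean
    [sigma * b / (1 + 2 * s)] and variance [sigma ^+ 2 / (1 + 2 * s)]. The term [x - 0] keeps the
    shape of the density at mean 0. *)
Lemma gauss_complete_square {F : realFieldType} (x sigma s b : F) :
  sigma != 0 -> 1 + 2 * s != 0 ->
  - (x - 0) ^+ 2 / (sigma ^+ 2 *+ 2) + (- s * (x / sigma) ^+ 2 + b * (x / sigma)) =
  b ^+ 2 / (2 * (1 + 2 * s)) +
  - (x - sigma * b / (1 + 2 * s)) ^+ 2 / (sigma ^+ 2 / (1 + 2 * s) *+ 2).
Proof.
by move=> s0 q0; field; rewrite s0 q0.
Qed.

Lemma normal_peak_div_sqrt {R : realType} (sigma q : R) : 0 < q ->
  normal_peak (sigma / Num.sqrt q) = normal_peak sigma * Num.sqrt q.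
Proof.
move=> q0; rewrite /normal_peak -[Num.sqrt q in RHS]invrK -invfM; congr (_^-1).
rewrite exprMn exprVn sqr_sqrtr ?ltW// -sqrtrV ?ltW// -sqrtrM; last first.
  by rewrite mulrn_wge0// mulr_ge0// ?sqr_ge0// pi_ge0.
move: pi => p; congr Num.sqrt.
by rewrite mulrnAl mulrAC.
Qed.

(** After completing the square, the integrand times the density is a constant times another normal
    density, whose total mass is 1. *)
Lemma integral_normal_prob_expR_quad {R : realType} (sigma s b : R) :
  0 < sigma -> 0 < 1 + 2 * s ->
  (\int[normal_prob 0 sigma]_x (expR (- s * (x / sigma) ^+ 2 + b * (x / sigma)))%:E =
   ((Num.sqrt (1 + 2 * s))^-1 * expR (b ^+ 2 / (2 * (1 + 2 * s))))%:E)%E.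
Proof.
set q := 1 + 2 * s => sigma0 q0.
have sq0 : 0 < Num.sqrt q by rewrite sqrtr_gt0.
rewrite ge0_integral_normal_prob; last 2 first.
- apply: measurableT_comp => //; apply: measurable_funD; apply: measurable_funM => //.
  by apply: measurable_funX; exact: measurable_funM.
  exact: measurable_funM.
- by move=> x; exact: expR_ge0.
pose K := (Num.sqrt q)^-1 * expR (b ^+ 2 / (2 * q)).
have K0 : 0 <= K by rewrite mulr_ge0 ?expR_ge0// invr_ge0 ltW.
transitivity (\int[lebesgue_measure]_x
    (K%:E * (normal_pdf (sigma * b / q) (sigma / Num.sqrt q) x)%:E))%E; last first.
  rewrite ge0_integralZl//=.
  - by rewrite integral_normal_pdf mule1.
  - by apply/measurable_EFinP; exact: measurable_normal_pdf.
  - by move=> x _; rewrite lee_fin normal_pdf_ge0.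
apply: eq_integral => x _; rewrite -EFinM; congr EFin.
rewrite !normal_pdfE ?gt_eqF ?divr_gt0//= normal_peak_div_sqrt// /normal_fun.
have -> : (sigma / Num.sqrt q) ^+ 2 = sigma ^+ 2 / q.
  by rewrite exprMn exprVn sqr_sqrtr// ltW.
rewrite -[LHS]mulrA -expRD gauss_complete_square ?gt_eqF// -/q expRD /K.
move: (normal_peak _) (expR _) (expR _) => p e1 e2.
move: (Num.sqrt q) sq0 => w w0.
by field; rewrite gt_eqF.
Qed.

(** This form, with a constant term and the sign of the square reversed, is the one used to
    integrate out the auxiliary normal variable. *)
Lemma integral_std_normal_expR_quad {R : realType} (u b kappa : R) :
  0 < 1 - 2 * kappa ->
  (\int[normal_prob 0 1]_h (expR (u + b * h + kappa * h ^+ 2))%:E =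
   ((Num.sqrt (1 - 2 * kappa))^-1 * expR (u + b ^+ 2 / (2 * (1 - 2 * kappa))))%:E)%E.
Proof.
move=> k0; have := integral_normal_prob_expR_quad 1 (- kappa) b ltr01.
rewrite mulrN => /(_ k0) quadE.
transitivity (\int[normal_prob 0 1]_h ((expR u)%:E *
    (expR (- (- kappa) * (h / 1) ^+ 2 + b * (h / 1)))%:E))%E.
  apply: eq_integral => h _; rewrite -EFinM -expRD; congr (expR _)%:E.
  by rewrite divr1; ring.
rewrite ge0_integralZl//=.
- by rewrite quadE -EFinM expRD mulrCA.
- apply/measurable_EFinP/measurableT_comp => //.
  apply: measurable_funD; apply: measurable_funM => //.
  by apply: measurable_funX; exact: measurable_funM.
  exact: measurable_funM.
Qed.

(** * Inner product and orthonormal families *)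

Definition dotv {R : realType} {D : nat} (u v : 'cV[R]_D) : R :=
  \sum_i u i 0 * v i 0.

Section dotv_theory.
Context {R : realType} {D : nat}.
Implicit Types u v w : 'cV[R]_D.

Lemma dotvC u v : dotv u v = dotv v u.
Proof. by apply: eq_bigr => i _; rewrite mulrC. Qed.

Lemma dotvDr u v w : dotv u (v + w) = dotv u v + dotv u w.
Proof. by rewrite -big_split; apply: eq_bigr => i _; rewrite mxE mulrDr. Qed.

Lemma dotvDl u v w : dotv (u + v) w = dotv u w + dotv v w.
Proof. by rewrite dotvC dotvDr !(dotvC w). Qed.

Lemma dotvZr a u v : dotv u (a *: v) = a * dotv u v.
Proof. by rewrite mulr_sumr; apply: eq_bigr => i _; rewrite mxE mulrCA. Qed.

Lemma dotvZl a u v : dotv (a *: u) v = a * dotv u v.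
Proof. by rewrite dotvC dotvZr dotvC. Qed.

Lemma dotv0r u : dotv u 0 = 0.
Proof. by rewrite /dotv big1// => i _; rewrite mxE mulr0. Qed.

Lemma dotv_sumr I (r : seq I) (Q : pred I) u (v : I -> 'cV[R]_D) :
  dotv u (\sum_(i <- r | Q i) v i) = \sum_(i <- r | Q i) dotv u (v i).
Proof. by apply: (big_morph _ (dotvDr u) (dotv0r u)). Qed.

End dotv_theory.

(** Indexing by [nat] with a bound [k] lets prefixes and shifted tails of a family be families
    again, without casts between ordinal types. *)
Definition orthonormal_seq {R : realType} {D : nat} (k : nat)
  (a : nat -> 'cV[R]_D) : Prop :=
  forall i j, (i < k)%N -> (j < k)%N -> dotv (a i) (a j) = (i == j)%:R.

(** * Exponential moments of Gaussian quadratic forms *)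

Section gaussian_quadratic_mgf.
Context {R : realType} {dT : measure_display} {T : measurableType dT}.
Context (P : probability T R) {D : nat} (sigma : R) (X : 'I_D -> T -> R).
Hypothesis sigma0 : 0 < sigma.
Hypothesis gaussX : gaussian_vector P sigma X.

Let g (t : T) : 'cV[R]_D := sigma^-1 *: vec_of X t.

Lemma measurable_dotv_gaussian (b : 'cV[R]_D) :
  measurable_fun setT (fun t => dotv b (sigma^-1 *: vec_of X t)).
Proof.
case: gaussX => mX _; apply: measurable_sum => i.
apply: measurable_funM => //; under eq_fun do rewrite !mxE.
exact: measurable_funM.
Qed.

Lemma measurable_sqr_gaussian :
  measurable_fun setT
    (fun t => dotv (sigma^-1 *: vec_of X t) (sigma^-1 *: vec_of X t)).
Proof.
case: gaussX => mX _; apply: measurable_sum => i.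
under eq_fun do rewrite !mxE.
by apply: measurable_funM => //; exact: measurable_funM.
Qed.

(** The exponent is a sum over coordinates, so independence factors the expectation into
    one-dimensional integrals. *)
Lemma gaussian_mgf_diag (s : R) (b : 'cV[R]_D) : 0 < 1 + 2 * s ->
  (\int[P]_t (expR (- s * dotv (g t) (g t) + dotv b (g t)))%:E =
   ((Num.sqrt (1 + 2 * s))^-1 ^+ D *
    expR (dotv b b / (2 * (1 + 2 * s))))%:E)%E.
Proof.
move=> q0; case: gaussX => mX [lawX indepX].
pose f (i : 'I_D) x := expR (- s * (x / sigma) ^+ 2 + b i 0 * (x / sigma)).
pose c (i : 'I_D) := (Num.sqrt (1 + 2 * s))^-1 *
  expR (b i 0 ^+ 2 / (2 * (1 + 2 * s))).
transitivity (\int[P]_t (\prod_i f i (X i t))%:E)%E.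
  apply: eq_integral => t _; rewrite -expR_sum; congr (expR _)%:E.
  rewrite /dotv mulr_sumr -big_split; apply: eq_bigr => i _ /=.
  by rewrite !mxE -expr2 ![sigma^-1 * _]mulrC.
rewrite (integral_prod_independent P X (normal_prob 0 sigma) _ _ _ f c)//.
- rewrite /c big_split prodr_const card_ord -expR_sum; congr (_ * expR _)%:E.
  by rewrite /dotv mulr_suml; apply: eq_bigr => i _; rewrite expr2.
- move=> i; apply: measurableT_comp => //; apply: measurable_funD; apply: measurable_funM => //.
  by apply: measurable_funX; exact: measurable_funM.
  exact: measurable_funM.
- by move=> i x; exact: expR_ge0.
- by move=> i; exact: integral_normal_prob_expR_quad.
Qed.

(* Columns enter one at a time: [expR (tau * w ^+ 2)] is the average of
   [expR (h * Num.sqrt (2 * tau) * w)] over a standard normal [h], so that by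
   Tonelli a square is traded for a shift of the linear term [b]. *)
Lemma gaussian_mgf_orthonormal (s tau : R) (a : nat -> 'cV[R]_D) (k : nat)
    (b : 'cV[R]_D) :
  0 <= tau -> 0 < 1 + 2 * s - 2 * tau -> orthonormal_seq k a ->
  (\int[P]_t (expR (- s * dotv (g t) (g t) + dotv b (g t) +
      tau * \sum_(i < k) dotv (a i) (g t) ^+ 2))%:E =
   ((Num.sqrt (1 + 2 * s))^-1 ^+ D *
    (Num.sqrt ((1 + 2 * s) / (1 + 2 * s - 2 * tau))) ^+ k *
    expR ((\sum_(i < k) dotv (a i) b ^+ 2) / (2 * (1 + 2 * s - 2 * tau)) +
      (dotv b b - \sum_(i < k) dotv (a i) b ^+ 2) / (2 * (1 + 2 * s))))%:E)%E.
Proof.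
move=> tau0 q1; elim: k b => [|k IH] b ak.
  under eq_integral do rewrite big_ord0 mulr0 addr0.
  rewrite gaussian_mgf_diag; last by lra.
  by rewrite big_ord0 expr0 mulr1 mul0r add0r subr0.
have aa : dotv (a k) (a k) = 1 by rewrite ak// eqxx.
have {}IH b' := IH b' (fun i j ik jk => ak i j (ltnW ik) (ltnW jk)).
have aia (i : 'I_k) : dotv (a i) (a k) = 0.
  by rewrite ak ?ltnS ?(ltnW (ltn_ord i))// ltn_eqF.
pose r := Num.sqrt (2 * tau).
have r2 : r ^+ 2 = 2 * tau by rewrite sqr_sqrtr// mulr_ge0.
pose G t := - s * dotv (g t) (g t) + dotv b (g t) +
  tau * \sum_(i < k) dotv (a i) (g t) ^+ 2.
pose f (z : T * measurableTypeR R) : \bar R :=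
  (expR (G z.1 + r * dotv (a k) (g z.1) * z.2))%:E.
have mG : measurable_fun setT G.
  apply: measurable_funD; first apply: measurable_funD.
  - by apply: measurable_funM => //; exact: measurable_sqr_gaussian.
  - exact: measurable_dotv_gaussian.
  - apply: measurable_funM => //; apply: measurable_sum => i.
    by apply: measurable_funX; exact: measurable_dotv_gaussian.
have mf : measurable_fun setT f.
  apply/measurable_EFinP/measurableT_comp => //; apply: measurable_funD.
    exact: (measurableT_comp mG measurable_fst).
  apply: measurable_funM; last exact: measurable_snd.
  apply: measurable_funM => //.
  exact: (measurableT_comp (measurable_dotv_gaussian (a k)) measurable_fst).
have f0 z : (0 <= f z)%E by rewrite lee_fin expR_ge0.
transitivity (\int[P]_t \int[normal_prob 0 1]_h f (t, h))%E.
  apply: eq_integral => t _; rewrite /f /=.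
  under [RHS]eq_integral => h _.
    rewrite (_ : _ + _ = G t + r * dotv (a k) (g t) * h + 0 * h ^+ 2); last first.
      by rewrite mul0r addr0.
    over.
  rewrite integral_std_normal_expR_quad ?mulr0 ?subr0// sqrtr1 invr1 mul1r mulr1.
  congr (expR _)%:E; rewrite big_ord_recr /= mulrDr addrA; congr (_ + _).
  by rewrite exprMn r2; field.
rewrite (fubini_tonelli f)//.
set q := 1 + 2 * s in q1 IH *; set q' := q - 2 * tau in q1 IH *.
have q0 : 0 < q by rewrite /q' in q1; lra.
set S := \sum_(i < k) dotv (a i) b ^+ 2.
pose u := S / (2 * q') + (dotv b b - S) / (2 * q).
set C := (Num.sqrt q)^-1 ^+ D * Num.sqrt (q / q') ^+ k.
have C0 : 0 <= C by rewrite mulr_ge0// exprn_ge0// invr_ge0.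
transitivity (\int[normal_prob 0 1]_h (C%:E * (expR (u +
    r * dotv (a k) b / q * h + tau / q * h ^+ 2))%:E))%E.
  apply: eq_integral => h _.
  have := IH (b + (r * h) *: a k); rewrite -/C => IHh.
  transitivity (\int[P]_t (expR (- s * dotv (g t) (g t) +
      dotv (b + (r * h) *: a k) (g t) +
      tau * \sum_(i < k) dotv (a i) (g t) ^+ 2))%:E)%E.
    apply: eq_integral => t _; rewrite /f /G /= dotvDl (dotvZl (r * h)).
    by congr (expR _)%:E; ring.
  rewrite IHh -EFinM; congr (_ * expR _)%:E.
  (* The shift is along [a k], orthogonal to the earlier vectors. Only the squared norm of the
     shifted [b] depends on [h], and what remains is one quadratic Gaussian integral in [h]. *)
  have -> : \sum_(i < k) dotv (a i) (b + (r * h) *: a k) ^+ 2 = S.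
    by apply: eq_bigr => i _; rewrite dotvDr dotvZr aia mulr0 addr0.
  rewrite dotvDr !dotvDl !dotvZr !dotvZl aa (dotvC b) /u.
  have -> : tau = r ^+ 2 / 2 by rewrite r2; field.
  by field; rewrite !gt_eqF.
(* This ratio yields the additional factor [Num.sqrt (q / q')] contributed by [a k]. *)
have k0 : 1 - 2 * (tau / q) = q' / q by rewrite /q'; field; rewrite gt_eqF.
rewrite ge0_integralZl//=.
- rewrite integral_std_normal_expR_quad; last by rewrite k0 divr_gt0.
  rewrite -EFinM k0 big_ord_recr/= -/S.
  rewrite -[X in X * expR (u + _)]sqrtrV; last by rewrite divr_ge0// ltW.
  rewrite invf_div mulrA; congr (_ * expR _)%:E; first by rewrite /C -mulrA -exprSr.
  rewrite /u /q'; have -> : tau = r ^+ 2 / 2 by rewrite r2; field.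
  have q'E : q - r ^+ 2 = q' by rewrite r2.
  by field; rewrite q'E !gt_eqF.
- apply/measurable_EFinP/measurableT_comp => //.
  apply: measurable_funD; first by apply: measurable_funD => //; exact: measurable_funM.
  by apply: measurable_funM => //; exact: measurable_funX.
Qed.

End gaussian_quadratic_mgf.

(** * Orthonormal bases and the distance to a subspace *)

Section orthonormal_completion.
Context {R : realType} {D : nat}.
Implicit Types (z : 'cV[R]_D) (a : nat -> 'cV[R]_D).

Lemma dotv_eq0 z : dotv z z = 0 -> z = 0.
Proof.
move/eqP; rewrite psumr_eq0 => [/allP z0|i _]; last by rewrite -expr2 sqr_ge0.
apply/colP => i; rewrite mxE; have := z0 i (mem_index_enum i).
by rewrite mulf_eq0 orbb => /eqP.
Qed.

Lemma dotv_ge0 z : 0 <= dotv z z.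
Proof. by apply: sumr_ge0 => i _; rewrite -expr2 sqr_ge0. Qed.

(** Fewer than [D] linear equations in [D] unknowns have a nonzero solution, which is then
    normalized. Since [kermx] is a left kernel, the vectors are the columns of [A] and the solution
    is a transposed row. *)
Lemma orthonormal_seq_extend1 k a : (k < D)%N ->
  exists v, dotv v v = 1 /\ forall i, (i < k)%N -> dotv (a i) v = 0.
Proof.
move=> kD; pose A : 'M[R]_(D, k) := \matrix_(j, i) a i j 0.
have kerA : kermx A != 0.
  rewrite -mxrank_eq0 mxrank_ker -lt0n subn_gt0.
  exact: leq_ltn_trans (rank_leq_col A) kD.
pose w : 'cV[R]_D := (nz_row (kermx A))^T.
have w0 : w != 0 by rewrite /w -trmx0 (inj_eq trmx_inj) nz_row_eq0.
have aw i : (i < k)%N -> dotv (a i) w = 0.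
  move=> ik; have /sub_kermxP/matrixP/(_ 0 (Ordinal ik)) := nz_row_sub (kermx A).
  rewrite !mxE => awE; rewrite -[RHS]awE; apply: eq_bigr => j _.
  by rewrite !mxE mulrC.
have ww : 0 < dotv w w.
  by rewrite lt_def dotv_ge0 andbT; apply: contra w0 => /eqP/dotv_eq0/eqP.
exists ((Num.sqrt (dotv w w))^-1 *: w); split => [|i ik].
  by rewrite dotvZl dotvZr mulrA -expr2 exprVn sqr_sqrtr ?mulVf ?gt_eqF// ltW.
by rewrite dotvZr aw// mulr0.
Qed.

(** Induction on the codimension [D - k], adding one unit vector at a time. *)
Lemma orthonormal_seq_complete k a : (k <= D)%N -> orthonormal_seq k a ->
  exists a', orthonormal_seq D a' /\ forall i, (i < k)%N -> a' i = a i.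
Proof.
move=> kD; have [n nE] : exists n, (D - k)%N = n by eexists.
elim: n k a kD nE => [|n IH] k a kD nE ak.
  have kE : k = D by apply/eqP; rewrite eqn_leq kD -subn_eq0 nE.
  by exists a; split => //; move: ak; rewrite {1}kE.
have {}kD : (k < D)%N by rewrite -subn_gt0 nE.
have [v [vv av]] := orthonormal_seq_extend1 k a kD.
pose a1 i := if i == k then v else a i.
have [||a' [a'D a'a1]] := IH k.+1 a1 kD.
- by rewrite subnS nE.
- move=> i j; rewrite !ltnS /a1 (leq_eqVlt i) (leq_eqVlt j).
  case: (eqVneq i k) => [->|ik] /=; case: (eqVneq j k) => [->|jk] //= ilt jlt.
  + by rewrite dotvC av.
  + by rewrite av// (negbTE ik).
  + exact: ak.
exists a'; split => // i ik.
by rewrite a'a1 ?ltnS 1?ltnW// /a1 ltn_eqF.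
Qed.

(** The square matrix with rows [a i] has its transpose as right inverse, hence also as left
    inverse, so it preserves the norm. *)
Lemma orthonormal_seq_parseval a z : orthonormal_seq D a ->
  dotv z z = \sum_(i < D) dotv (a i) z ^+ 2.
Proof.
move=> aD; pose M : 'M[R]_D := \matrix_(i, j) a i j 0.
have MMt : M *m M^T = 1%:M.
  apply/matrixP => i j; rewrite !mxE -[RHS](aD i j (ltn_ord i) (ltn_ord j)).
  by apply: eq_bigr => l _; rewrite !mxE.
have MtM := mulmx1C MMt.
have dotE (n : nat) (x : 'cV[R]_n) : \sum_i x i 0 ^+ 2 = (x^T *m x) 0 0.
  by rewrite !mxE; apply: eq_bigr => i _; rewrite !mxE expr2.
transitivity (\sum_i (M *m z) i 0 ^+ 2).
  rewrite dotE trmx_mul mulmxA -(mulmxA z^T) MtM mulmx1 mxE.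
  by apply: eq_bigr => i _; rewrite !mxE.
by apply: eq_bigr => i _; rewrite mxE; congr (_ ^+ 2); apply: eq_bigr => j _; rewrite mxE.
Qed.

Lemma norm2_ge0 z : 0 <= norm2 z.
Proof. exact: sqrtr_ge0. Qed.

Lemma sqr_norm2 z : norm2 z ^+ 2 = dotv z z.
Proof.
rewrite sqr_sqrtr; last by apply: sumr_ge0 => i _; rewrite sqr_ge0.
by apply: eq_bigr => i _; rewrite expr2.
Qed.

(** The witness completes the columns of [U] to a basis, and the formula is Pythagoras. With
    Parseval, the full basis also expresses the distance through its last [D - d] vectors. *)
Lemma dist_sub_basis d (U : 'M[R]_(D, d)) : (d <= D)%N -> orthonormal_cols U ->
  exists a, orthonormal_seq D a /\
    (forall z, dist_sub U z ^+ 2 = dotv z z - \sum_(i < d) dotv (a i) z ^+ 2).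
Proof.
move=> dD oU.
(* The value 0 beyond [d] is only a default. *)
pose a i : 'cV[R]_D := if insub i is Some j then col j U else 0.
have aE (i : 'I_d) : a i = col i U by rewrite /a valK.
have ad : orthonormal_seq d a.
  move=> i j id jd; rewrite (aE (Ordinal id)) (aE (Ordinal jd)).
  have /matrixP/(_ (Ordinal id) (Ordinal jd)) := oU.
  rewrite !mxE => <-; apply: eq_bigr => l _; by rewrite !mxE.
have [a' [a'D a'a]] := orthonormal_seq_complete d a dD ad.
exists a'; split => // z.
have UtzE (i : 'I_d) : (U^T *m z) i 0 = dotv (a' i) z.
  by rewrite a'a// aE mxE; apply: eq_bigr => j _; rewrite !mxE.
rewrite /dist_sub; have -> : U *m (U^T *m z) = \sum_(i < d) dotv (a' i) z *: a' i.
  apply/colP => j; rewrite mxE summxE; apply: eq_bigr => i _.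
  by rewrite UtzE a'a// aE !mxE mulrC.
rewrite sqr_norm2; set w := \sum_(i < d) _.
have aw (i : 'I_d) : dotv (a' i) w = dotv (a' i) z.
  rewrite dotv_sumr (bigD1 i)//= dotvZr a'D ?(leq_trans (ltn_ord _))// eqxx mulr1.
  rewrite big1 ?addr0// => j ji; rewrite dotvZr a'D ?(leq_trans (ltn_ord _))//.
  by rewrite -[val i == j]/(i == j) eq_sym (negbTE ji) mulr0.
have zw : dotv z w = \sum_(i < d) dotv (a' i) z ^+ 2.
  by rewrite dotv_sumr; apply: eq_bigr => i _; rewrite dotvZr (dotvC z) expr2.
have ww : dotv w w = \sum_(i < d) dotv (a' i) z ^+ 2.
  rewrite {2}/w dotv_sumr; apply: eq_bigr => i _.
  by rewrite dotvZr (dotvC w) aw expr2.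
rewrite -scaleN1r dotvDr !dotvDl !dotvZr !dotvZl (dotvC w) zw ww; ring.
Qed.

End orthonormal_completion.

(** * Concentration of the distance to a subspace *)

Lemma dist_subZ {R : realType} {D d : nat} (U : 'M[R]_(D, d)) c z :
  dist_sub U (c *: z) = `|c| * dist_sub U z.
Proof.
rewrite /dist_sub -!scalemxAr -scalerBr /norm2 -sqrtr_sqr -sqrtrM ?sqr_ge0//.
by rewrite mulr_sumr; congr Num.sqrt; apply: eq_bigr => i _; rewrite mxE exprMn.
Qed.

Section distance_concentration.
Context {R : realType} {dT : measure_display} {T : measurableType dT}.
Context (P : probability T R) {D : nat} (sigma : R) (X : 'I_D -> T -> R).
Hypothesis sigma0 : 0 < sigma.
Hypothesis gaussX : gaussian_vector P sigma X.

Let g (t : T) : 'cV[R]_D := sigma^-1 *: vec_of X t.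

(** Expanding the squares around [v] leaves the centred case with an additional linear term. In the
    result, the projection of [v] on the family carries the rate [tau - s] and its orthogonal part
    the rate [- s]. *)
Lemma gaussian_mgf_orthonormal_shift (s tau : R) (a : nat -> 'cV[R]_D) (k : nat)
    (v : 'cV[R]_D) (N := \sum_(i < k) dotv (a i) v ^+ 2) :
  0 <= tau -> 0 < 1 + 2 * s - 2 * tau -> orthonormal_seq k a ->
  (\int[P]_t (expR (- s * dotv (v + g t) (v + g t) +
      tau * \sum_(i < k) dotv (a i) (v + g t) ^+ 2))%:E =
   ((Num.sqrt (1 + 2 * s))^-1 ^+ D *
    (Num.sqrt ((1 + 2 * s) / (1 + 2 * s - 2 * tau))) ^+ k *
    expR ((tau - s) * N / (1 + 2 * s - 2 * tau) -
      s * (dotv v v - N) / (1 + 2 * s)))%:E)%E.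
Proof.
move=> tau0 q1 ak.
pose w := \sum_(i < k) dotv (a i) v *: a i.
have wE z : dotv w z = \sum_(i < k) dotv (a i) v * dotv (a i) z.
  by rewrite dotvC dotv_sumr; apply: eq_bigr => i _; rewrite dotvZr (dotvC z).
have aw (i : 'I_k) : dotv (a i) w = dotv (a i) v.
  rewrite dotv_sumr (bigD1 i)//= dotvZr ak// eqxx mulr1.
  rewrite big1 ?addr0// => j ji; rewrite dotvZr ak//.
  by rewrite -[val i == j]/(i == j) eq_sym (negbTE ji) mulr0.
have vw : dotv v w = N.
  by rewrite dotvC wE; apply: eq_bigr => i _; rewrite expr2.
have ww : dotv w w = N.
  by rewrite wE; apply: eq_bigr => i _; rewrite aw expr2.
(* The cross terms of the two expanded squares; [w] is the projection of [v] on the family. *)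
pose b := (- 2 * s) *: v + (2 * tau) *: w.
have bb : dotv b b = 4 * s ^+ 2 * dotv v v + (4 * tau ^+ 2 - 8 * s * tau) * N.
  by rewrite dotvDr !dotvDl !dotvZr !dotvZl (dotvC w) vw ww; ring.
have Sb : \sum_(i < k) dotv (a i) b ^+ 2 = 4 * (tau - s) ^+ 2 * N.
  rewrite mulr_sumr; apply: eq_bigr => i _.
  by rewrite dotvDr !dotvZr aw; ring.
pose u := - s * dotv v v + tau * N.
transitivity (\int[P]_t ((expR u)%:E * (expR (- s * dotv (g t) (g t) + dotv b (g t) +
    tau * \sum_(i < k) dotv (a i) (g t) ^+ 2))%:E))%E.
  apply: eq_integral => t _; rewrite -EFinM -expRD; congr (expR _)%:E.
  have -> : \sum_(i < k) dotv (a i) (v + g t) ^+ 2 =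
      N + 2 * dotv w (g t) + \sum_(i < k) dotv (a i) (g t) ^+ 2.
    rewrite wE mulr_sumr -!big_split; apply: eq_bigr => i _ /=.
    by rewrite (dotvDr (a i)); ring.
  rewrite (dotvDr _ v) !(dotvDl v) (dotvC (g t) v) /b dotvDl.
  by rewrite (dotvZl (- 2 * s)) (dotvZl (2 * tau)) /u; ring.
rewrite ge0_integralZl//=; last first.
  apply/measurable_EFinP/measurableT_comp => //.
  apply: measurable_funD; first apply: measurable_funD.
  - apply: measurable_funM => //; exact: measurable_sqr_gaussian gaussX.
  - exact: measurable_dotv_gaussian gaussX _.
  - apply: measurable_funM => //; apply: measurable_sum => i.
    by apply: measurable_funX; exact: measurable_dotv_gaussian gaussX _.
rewrite (gaussian_mgf_orthonormal P sigma X)// -EFinM mulrCA -expRD Sb bb.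
congr (_ * expR _)%:E; rewrite /u.
have q0 : 0 < 1 + 2 * s by lra.
by field; rewrite !gt_eqF.
Qed.

Section subspace.
Context {d : nat} (U : 'M[R]_(D, d)).
Hypothesis dD : (d <= D)%N.
Hypothesis oU : orthonormal_cols U.

Lemma measurable_dist_sub_gaussian (x : 'cV[R]_D) :
  measurable_fun setT (fun t => dist_sub U (x + vec_of X t)).
Proof.
apply: measurableT_comp.
  by apply: continuous_measurable_fun; exact: sqrt_continuous.
case: gaussX => mX _.
have mlin n (M : 'M[R]_(n, D)) i j :
    measurable_fun setT (fun t => (M *m (x + vec_of X t)) i j).
  under eq_fun do rewrite mxE.
  apply: measurable_sum => l; apply: measurable_funM => //.
  by under eq_fun do rewrite !mxE; exact: measurable_funD.
apply: measurable_sum => i; apply: measurable_funX.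
under eq_fun do rewrite mulmxA -{1}[x + vec_of X _]mul1mx -mulmxBl.
exact: mlin.
Qed.

(** The rate is chosen so that one minus twice its value is the inverse of [kappa]. *)
Lemma dist_sub_mgf (kappa : R) (v : 'cV[R]_D) : 0 < kappa ->
  (\int[P]_t (expR ((kappa - 1) / (2 * kappa) * dist_sub U (v + g t) ^+ 2))%:E =
   (Num.sqrt kappa ^+ (D - d) *
    expR ((kappa - 1) / 2 * dist_sub U v ^+ 2))%:E)%E.
Proof.
move=> k0; have [a [aD distE]] := dist_sub_basis d U dD oU.
have [k1|k1] := leP 1 kappa.
  (* Nonnegative rate: the last [D - d] basis vectors, with [s = 0] and [tau] the rate. *)
  pose e i := a (d + i)%N.
  have eE z : dist_sub U z ^+ 2 = \sum_(i < D - d) dotv (e i) z ^+ 2.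
    rewrite distE (orthonormal_seq_parseval a)//.
    rewrite -(big_mkord predT (fun i => dotv (a i) z ^+ 2)).
    rewrite (big_cat_nat (n := d))//= big_mkord addrAC subrr add0r.
    by rewrite -{1}[d]add0n big_addn big_mkord; apply: eq_bigr => i _; rewrite addnC.
  have eD : orthonormal_seq (D - d) e.
    move=> i j iD jD; by rewrite /e aD ?eqn_add2l -?ltn_subRL.
  pose th := (kappa - 1) / (2 * kappa).
  have th0 : 0 <= th by rewrite divr_ge0 ?subr_ge0// mulr_ge0// ltW.
  have thE : 1 + 2 * 0 - 2 * th = kappa^-1 by rewrite /th; field; rewrite gt_eqF.
  transitivity (\int[P]_t (expR (- 0 * dotv (v + g t) (v + g t) +
      th * \sum_(i < D - d) dotv (e i) (v + g t) ^+ 2))%:E)%E.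
    by apply: eq_integral => t _; rewrite oppr0 mul0r add0r eE.
  rewrite gaussian_mgf_orthonormal_shift//; last by rewrite thE invr_gt0.
  rewrite thE mulr0 addr0 sqrtr1 invr1 expr1n mul1r invrK mul0r subr0 mul0r subr0.
  rewrite ?mul1r -eE; congr (_ * expR _)%:E; rewrite /th; field.
  by rewrite gt_eqF.
(* Negative rate: [s] and [tau] are both its opposite, on the basis of the subspace. The part of [v]
   in the subspace then drops out, and [d] of the [D] factors [Num.sqrt kappa] cancel. *)
pose s := (1 - kappa) / (2 * kappa).
have s0 : 0 <= s by rewrite divr_ge0 ?subr_ge0 ?(ltW k1)// mulr_ge0// ltW.
have sE : 1 + 2 * s = kappa^-1 by rewrite /s; field; rewrite gt_eqF.
transitivity (\int[P]_t (expR (- s * dotv (v + g t) (v + g t) +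
    s * \sum_(i < d) dotv (a i) (v + g t) ^+ 2))%:E)%E.
  apply: eq_integral => t _; rewrite distE /s; congr (expR _)%:E; field.
  by rewrite gt_eqF.
rewrite gaussian_mgf_orthonormal_shift//; last 2 first.
- by rewrite addrK.
- by move=> i j id jd; rewrite aD// (leq_trans _ dD).
rewrite sE {1}sqrtrV ?(ltW k0)// invrK -distE.
have -> : kappa^-1 - 2 * s = 1 by rewrite -sE addrK.
rewrite divr1 subrr mul0r mul0r sub0r sqrtrV ?(ltW k0)// exprVn.
congr (_ * expR _)%:E.
  rewrite -{1}(subnK dD) exprD mulfK// expf_neq0// gt_eqF//.
  by rewrite sqrtr_gt0.
by rewrite /s; field; rewrite gt_eqF.
Qed.

(* The Chernoff exponent [(kappa - 1) / (2 * kappa)] serves both tails: the upper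
   one for [1 < kappa] and the lower one for [kappa < 1]. *)
Lemma dist_sub_tail (kappa : R) (x : 'cV[R]_D)
    (r := Num.sqrt (sigma ^+ 2 * (D - d)%N%:R + dist_sub U x ^+ 2)) : 0 < kappa ->
  (P [set t | 0 <= (kappa - 1) * (dist_sub U (x + vec_of X t) - kappa * r)]%R <=
   (expR (- (2^-1 * (kappa - 1) ^+ 2 * (D - d)%N%:R)))%:E)%E.
Proof.
move=> k0; set m := (D - d)%N in r *; set A := [set t | _].
have mA : measurable A.
  rewrite -[A]setTI; apply: measurable_fun_le => //; apply: measurable_funM => //.
  by apply: measurable_funB => //; exact: measurable_dist_sub_gaussian.
pose v := sigma^-1 *: x.
have distZ t : dist_sub U (v + g t) ^+ 2 = sigma^-1 ^+ 2 * dist_sub U (x + vec_of X t) ^+ 2.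
  by rewrite -scalerDr dist_subZ exprMn real_normK ?num_real.
have distv : dist_sub U v ^+ 2 = sigma^-1 ^+ 2 * dist_sub U x ^+ 2.
  by rewrite dist_subZ exprMn real_normK ?num_real.
have r2 : r ^+ 2 = sigma ^+ 2 * m%:R + dist_sub U x ^+ 2.
  by rewrite sqr_sqrtr// addr_ge0 ?sqr_ge0// mulr_ge0 ?sqr_ge0.
pose th := (kappa - 1) / (2 * kappa).
pose rho2 := m%:R + dist_sub U v ^+ 2.
have rho2E : rho2 = sigma^-1 ^+ 2 * r ^+ 2.
  by rewrite /rho2 distv r2; field; rewrite gt_eqF.
pose c := th * kappa ^+ 2 * rho2.
have mdist : measurable_fun setT (fun t => dist_sub U (v + g t) ^+ 2).
  under eq_fun do rewrite distZ.
  apply: measurable_funM => //; apply: measurable_funX.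
  exact: measurable_dist_sub_gaussian.
(* A difference of squares: [y + kappa * r] is nonnegative, so the sign is that of
   [(kappa - 1) * (y - kappa * r)], for either tail. *)
have AE t : A t -> c <= th * dist_sub U (v + g t) ^+ 2.
  rewrite /A /= => At; rewrite -subr_ge0 /c rho2E distZ.
  set y := dist_sub U _ in At *.
  have -> : th * (sigma^-1 ^+ 2 * y ^+ 2) - th * kappa ^+ 2 * (sigma^-1 ^+ 2 * r ^+ 2) =
      (2 * kappa)^-1 * sigma^-1 ^+ 2 * (y + kappa * r) * ((kappa - 1) * (y - kappa * r)).
    by rewrite /th; field; rewrite !gt_eqF.
  rewrite mulr_ge0// !mulr_ge0 ?invr_ge0 ?mulr_ge0 ?(ltW k0) ?(ltW sigma0)//.
  by rewrite addr_ge0 ?sqrtr_ge0// mulr_ge0 ?sqrtr_ge0// ltW.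
rewrite -integralT_indic//.
apply: (@le_trans _ _ (\int[P]_t ((expR (- c))%:E *
    (expR (th * dist_sub U (v + g t) ^+ 2))%:E))%E).
  apply: ge0_le_integral => //=.
  - exact/measurable_EFinP/measurable_indic.
  - apply/measurable_EFinP/measurable_funM => //; apply: measurableT_comp => //.
    exact: measurable_funM.
  - move=> t _; rewrite -EFinM -expRD lee_fin indicE.
    case: (boolP (t \in A)) => [/set_mem/AE At|_]; last exact: expR_ge0.
    by rewrite -expR0 ler_expR addrC subr_ge0.
rewrite ge0_integralZl//=; last first.
  by apply/measurable_EFinP/measurableT_comp => //; exact: measurable_funM.
rewrite dist_sub_mgf// -EFinM lee_fin.
(* The square root of [kappa <= expR (kappa - 1)]. *)
have sk : Num.sqrt kappa <= expR ((kappa - 1) / 2).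
  rewrite -(@ler_pXn2r _ 2)// ?nnegrE ?sqrtr_ge0 ?expR_ge0// sqr_sqrtr ?(ltW k0)//.
  rewrite -expRM_natl; apply: le_trans (expR_ge1Dx _).
  by rewrite le_eqVlt; apply/orP; left; apply/eqP; field.
apply: (@le_trans _ _ (expR (- c) * (expR ((kappa - 1) / 2) ^+ m *
    expR ((kappa - 1) / 2 * dist_sub U v ^+ 2)))).
  rewrite ler_wpM2l ?expR_ge0// ler_wpM2r ?expR_ge0//.
  by rewrite lerXn2r ?nnegrE ?sqrtr_ge0 ?expR_ge0.
rewrite -expRM_natl -!expRD ler_expR -subr_ge0.
(* The noncentrality only improves the exponent; its nonnegative contribution is discarded. *)
have -> : - (2^-1 * (kappa - 1) ^+ 2 * m%:R) - (- c + (m%:R * ((kappa - 1) / 2) +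
    (kappa - 1) / 2 * dist_sub U v ^+ 2)) = 2^-1 * (kappa - 1) ^+ 2 * dist_sub U v ^+ 2.
  by rewrite /c /th /rho2; field; rewrite gt_eqF.
by rewrite mulr_ge0 ?sqr_ge0// mulr_ge0 ?sqr_ge0 ?invr_ge0.
Qed.

End subspace.

End distance_concentration.

(** * From the two distances to the score *)

Lemma dist_sub_in_span {R : realType} {D d : nat} (U : 'M[R]_(D, d)) x :
  orthonormal_cols U -> in_span U x -> dist_sub U x = 0.
Proof.
move=> oU [a ->]; rewrite /dist_sub (mulmxA U^T) oU mul1mx subrr /norm2.
by rewrite big1 ?sqrtr0// => i _; rewrite mxE expr0n.
Qed.

(** The lower bounds make [y] and [z] positive, so the quotient is monotone in each. The assumptions
    are strict because the tail events include equality. *)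
Lemma ratio_bounds {F : realFieldType} (eps s r y z : F) :
  0 < eps < 1 -> 0 < s -> 0 < r ->
  (1 - eps) * s < y < (1 + eps) * s -> (1 - eps) * r < z < (1 + eps) * r ->
  1 - (1 + eps) * s / ((1 - eps) * r) <= 1 - y / z <=
    1 - (1 - eps) * s / ((1 + eps) * r).
Proof.
move=> /andP[e0 e1] s0 r0 /andP[ly uy] /andP[lz uz].
have e1' : 0 < 1 - eps by rewrite subr_gt0.
have e2' : 0 < 1 + eps by rewrite addr_gt0.
have lr0 : 0 < (1 - eps) * r by rewrite mulr_gt0.
have z0 : 0 < z := lt_trans lr0 lz.
have y0 : 0 < y by rewrite (lt_trans _ ly)// mulr_gt0.
apply/andP; split; rewrite lerD2l lerN2.
  by apply: ler_pM; rewrite ?invr_ge0 ?(ltW y0) ?(ltW z0) ?(ltW uy)// lef_pV2 ?(ltW lz).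
apply: ler_pM; rewrite ?(ltW ly)//.
- by rewrite mulr_ge0 ?ltW.
- by rewrite invr_ge0 mulr_ge0 ?ltW.
- by rewrite lef_pV2 ?(ltW uz)// posrE mulr_gt0.
Qed.

Theorem theorem1 (R : realType) :
  exists c : R, 0 < c /\
  forall (D d : nat), (1 <= d)%N -> (d < D)%N ->
  forall (sigma : R), 0 < sigma ->
  forall (U1 U2 : 'M[R]_(D, d)), orthonormal_cols U1 -> orthonormal_cols U2 ->
  forall (x : 'cV[R]_D), in_span U1 x ->
  forall (dT : measure_display) (T : measurableType dT) (P : probability T R)
         (X : 'I_D -> T -> R), gaussian_vector P sigma X ->
  forall eps : R, 0 < eps < 1 ->
  let s := Num.sqrt (sigma ^+ 2 * (D - d)%N%:R) in
  let r := Num.sqrt (sigma ^+ 2 * (D - d)%N%:R + dist_sub U2 x ^+ 2) in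
  ((1 - 4 * expR (- (c * eps ^+ 2 * (D - d)%N%:R)))%:E <=
   P [set t | (1 - (1 + eps) * s / ((1 - eps) * r) <= mu_score U1 U2 (x + vec_of X t)
              <= 1 - (1 - eps) * s / ((1 + eps) * r))%R])%E.
Proof.
exists 2^-1; split => [|D d _ dD sigma sigma0 U1 U2 oU1 oU2 x xU1 dT T P X gX eps eps01].
  by rewrite invr_gt0.
cbv zeta; set s := Num.sqrt (sigma ^+ 2 * _); set r := Num.sqrt (_ + _).
set E := [set t | _]; set p := expR _.
have dD' := ltnW dD.
have md d' (U : 'M[R]_(D, d')) := measurable_dist_sub_gaussian P sigma X gX U x.
have mE : measurable E.
  have mmu : measurable_fun setT (fun t => mu_score U1 U2 (x + vec_of X t)).
    apply: measurable_funB => //; apply: measurable_funM; first exact: md.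
    (* Inversion is treated as the real power [-1], which agrees with it on all nonnegative reals,
       zero included. *)
    under eq_fun do rewrite -powR_inv1 ?norm2_ge0//.
    exact: (measurableT_comp (measurable_powR (-1)) (md _ U2)).
  have -> : E = [set t | 1 - (1 + eps) * s / ((1 - eps) * r) <=
        mu_score U1 U2 (x + vec_of X t)] `&`
      [set t | mu_score U1 U2 (x + vec_of X t) <= 1 - (1 - eps) * s / ((1 + eps) * r)].
    by rewrite /E; apply/seteqP; split => t /= => [/andP[]//|[-> ->]].
  by apply: measurableI; rewrite -[X in measurable X]setTI; apply: measurable_fun_le.
(* The sign of [k - 1] selects the tail: too large a distance for [k = 1 + eps], too small for
   [k = 1 - eps]. *)
pose B (U : 'M[R]_(D, d)) (rU k : R) :=
  [set t | 0 <= (k - 1) * (dist_sub U (x + vec_of X t) - k * rU)].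
have mB U rU k : measurable (B U rU k).
  rewrite -[B U rU k]setTI; apply: measurable_fun_le => //; apply: measurable_funM => //.
  by apply: measurable_funB => //; exact: md.
have m0 : 0 < sigma ^+ 2 * (D - d)%N%:R.
  by rewrite mulr_gt0 ?exprn_gt0// ltr0n subn_gt0.
have s0 : 0 < s by rewrite sqrtr_gt0.
have r0 : 0 < r by rewrite sqrtr_gt0 ltr_wpDr// sqr_ge0.
(* As [x] lies in the first subspace, [s] has the same form as [r], and one tail bound covers both
   subspaces. *)
have sE : s = Num.sqrt (sigma ^+ 2 * (D - d)%N%:R + dist_sub U1 x ^+ 2).
  by rewrite dist_sub_in_span// expr0n addr0.
have [e0 e1] := andP eps01.
have PB U rU : orthonormal_cols U ->
    rU = Num.sqrt (sigma ^+ 2 * (D - d)%N%:R + dist_sub U x ^+ 2) ->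
    (P (B U rU (1 + eps)%R `|` B U rU (1 - eps)%R) <= p%:E + p%:E)%E.
  move=> oU ->; apply: (le_trans (measureU2 _ (mB _ _ _) (mB _ _ _))); apply: leeD.
    rewrite (_ : p = expR (- (2^-1 * (1 + eps - 1) ^+ 2 * (D - d)%N%:R))).
      by apply: (dist_sub_tail P sigma X) => //; rewrite addr_gt0.
    by rewrite addrAC subrr add0r.
  rewrite (_ : p = expR (- (2^-1 * (1 - eps - 1) ^+ 2 * (D - d)%N%:R))).
    by apply: (dist_sub_tail P sigma X) => //; rewrite subr_gt0.
  by rewrite addrAC subrr add0r sqrrN.
pose F := B U1 s (1 + eps) `|` B U1 s (1 - eps) `|`
  (B U2 r (1 + eps) `|` B U2 r (1 - eps)).
have mF : measurable F by apply: measurableU; apply: measurableU; exact: mB.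
have PF : (P F <= (4 * p)%:E)%E.
  have -> : 4 * p = p + p + (p + p) by ring.
  rewrite !EFinD.
  apply: (le_trans (measureU2 _ (measurableU _ _ (mB _ _ _) (mB _ _ _))
    (measurableU _ _ (mB _ _ _) (mB _ _ _)))).
  by apply: leeD; exact: PB.
have FE : ~` F `<=` E.
  move=> t /= Ft; apply: ratio_bounds => //; apply/andP; split.
  - rewrite ltNge; apply/negP => h; apply: Ft; left; right.
    by rewrite /B /= mulr_le0// ?subr_le0// gerBl ltW.
  - rewrite ltNge; apply/negP => h; apply: Ft; left; left.
    by rewrite /B /= mulr_ge0// ?subr_ge0// lerDl ltW.
  - rewrite ltNge; apply/negP => h; apply: Ft; right; right.
    by rewrite /B /= mulr_le0// ?subr_le0// gerBl ltW.
  - rewrite ltNge; apply/negP => h; apply: Ft; right; left.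
    by rewrite /B /= mulr_ge0// ?subr_ge0// lerDl ltW.
apply: (@le_trans _ _ (P (~` F))); last first.
  by apply: le_measure => //; apply/mem_set => //; exact: measurableC.
by rewrite probability_setC// EFinB leeB.
Qed.
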